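(* Let $(X,d,\mu)$ be a complete metric measure space with $\mu$ a doubling measure. Let $0<\theta<1$ and $1\le q<\infty$. Then $(X,d,\mu)$ supports a $(\theta,q,1)_{BBM}$-Poincaré inequality if and only if it supports a $(\theta,q,1)_{BBM}$-relative isoperimetric inequality.
   Context: A metric measure space $(X,d,\mu)$ is a metric space with a Borel regular outer measure $\mu$. Balls $B(x,r)=\{y\in X:d(x,y)<r\}$ are open and come with a prescribed center and radius; for $B=B(x,r)$, $\lambda B:=B(x,\lambda r)$. The measure $\mu$ is doubling with constant $C_\mu\ge1$ if $0<\mu(B(x,2r))\le C_\mu\,\mu(B(x,r))<\infty$ for all $x\in X$, $r>0$. We write $u_B=\frac1{\mu(B)}\int_B u\,d\mu$. $L^1_{\mathrm{loc}}(X)$ consists of the functions integrable on every open set with compact closure (complete doubling spaces are proper, so equivalently on every ball). For $0<\theta<1$, measurable $E\subset X$ and open $\Omega\subset X$, the fractional $\theta$-perimeter is $$P_\theta(E,\Omega)=\int_{\Omega\cap E}\int_{\Omega\setminus E}\frac{2}{d(x,y)^\theta[\mu(B(x,d(x,y)))+\mu(B(y,d(x,y)))]}\,d\mu(y)\,d\mu(x).$$ $(X,d,\mu)$ supports a $(\theta,q,1)_{BBM}$-Poincaré inequality if there exist $C,\tau\ge1$ such that for all balls $B=B(x_0,r)$ and all $u\in L^1_{\mathrm{loc}}(X)$, $$\left(\frac1{\mu(B)}\int_B|u-u_B|^q\,d\mu\right)^{1/q}\le C(1-\theta)r^\theta\frac1{\mu(\tau B)}\int_{\tau B}\int_{\tau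 B}\frac{|u(x)-u(y)|}{d(x,y)^\theta\mu(B(x,d(x,y)))}\,d\mu(y)\,d\mu(x)$$ (the integrand being read as $0$ for $x=y$). $(X,d,\mu)$ supports a $(\theta,q,1)_{BBM}$-relative isoperimetric inequality if there exist $C,\tau\ge1$ such that for all balls $B=B(x_0,r)$ and all measurable $E\subset X$, $$\left(\frac{\min\{\mu(B\cap E),\mu(B\setminus E)\}}{\mu(B)}\right)^{1/q}\le C(1-\theta)r^\theta\frac{P_\theta(E,\tau B)}{\mu(\tau B)}.$$ In both definitions $C$ and $\tau$ may depend on structural data of $X$ but not on $\theta$, $u$, $B$, $E$. *)

(* Defs.v *)
From HB Require Import structures.
From mathcomp Require Import all_boot all_order all_algebra.
From mathcomp Require Import all_classical all_reals all_analysis.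

Set Implicit Arguments.
Unset Strict Implicit.
Unset Printing Implicit Defensive.

Import Order.TTheory GRing.Theory Num.Theory.
Import numFieldNormedType.Exports.

Local Open Scope classical_set_scope.
Local Open Scope ring_scope.

(* [Complete] carries a base point, so the empty space is excluded; all the
   properties below would be vacuous for it. *)
#[short(type="completeMetricType")]
HB.structure Definition CompleteMetric (R : realType) :=
  { T of Metric R T & Complete T }.

Section BBM.
Context {R : realType} {X : completeMetricType R}.
Variable mu : {outer_measure set X -> \bar R}.

Implicit Types (E Omega B : set X) (u : X -> R) (theta q C tau r : R).

(* mu restricted to its Caratheodory measurable sets; every integral below is
   taken with respect to it. *)
Definition cara_measure : {measure set (caratheodory_type mu) -> \bar R} :=
  (mu : set (caratheodory_type mu) -> \bar R).

Definition borel_set : set (set X) := <<s @open X >>.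

Definition borel_regular :=
  borel_set `<=` mu.-caratheodory /\
  forall A : set X, exists2 B, borel_set B & A `<=` B /\ mu B = mu A.

Definition doubling := exists2 Cmu : R, 1 <= Cmu &
  forall (x : X) r, 0 < r ->
    (0 < mu (ball x (2 * r)) /\
     mu (ball x (2 * r)) <= Cmu%:E * mu (ball x r) /\
     Cmu%:E * mu (ball x r) < +oo)%E.

Definition L1loc u := forall U : set X, open U -> compact (closure U) ->
  cara_measure.-integrable U (EFin \o u).

Definition avg u B : R :=
  (fine (mu B))^-1 * \int[cara_measure]_(x in B) u x.

(* Only evaluated at x <> y, where doubling makes both ball measures finite and
   positive, so that [fine] loses nothing. *)
Definition perimeter_kernel theta (x y : X) : R :=
  2 / (mdist x y `^ theta *
       (fine (mu (ball x (mdist x y))) + fine (mu (ball y (mdist x y))))).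

Definition fractional_perimeter theta E Omega : \bar R :=
  (\int[cara_measure]_(x in Omega `&` E)
     \int[cara_measure]_(y in Omega `\` E) (perimeter_kernel theta x y)%:E)%E.

(* For x = y the numerator is 0, hence so is the quotient. *)
Definition poincare_kernel theta u (x y : X) : R :=
  `|u x - u y| / (mdist x y `^ theta * fine (mu (ball x (mdist x y)))).

Definition BBM_poincare_with theta q C tau :=
  forall (x0 : X) r, 0 < r -> forall u, L1loc u ->
  let B := ball x0 r in
  let tauB := ball x0 (tau * r) in
  (((fine (mu B))^-1%:E *
      \int[cara_measure]_(x in B) ((`|u x - avg u B| `^ q)%R)%:E) `^ q^-1
   <= (C * (1 - theta) * r `^ theta)%:E *
      ((fine (mu tauB))^-1%:E *
       \int[cara_measure]_(x in tauB) \int[cara_measure]_(y in tauB)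
         (poincare_kernel theta u x y)%:E))%E.

Definition BBM_isoperimetric_with theta q C tau :=
  forall (x0 : X) r, 0 < r -> forall E, mu.-cara.-measurable E ->
  let B := ball x0 r in
  let tauB := ball x0 (tau * r) in
  ((mine (mu (B `&` E)) (mu (B `\` E)) * (fine (mu B))^-1%:E) `^ q^-1
   <= (C * (1 - theta) * r `^ theta)%:E *
      (fractional_perimeter theta E tauB * (fine (mu tauB))^-1%:E))%E.

Definition supports_BBM_poincare theta q :=
  exists C tau, [/\ 1 <= C, 1 <= tau & BBM_poincare_with theta q C tau].

Definition supports_BBM_isoperimetric theta q :=
  exists C tau, [/\ 1 <= C, 1 <= tau & BBM_isoperimetric_with theta q C tau].

End BBM.

(* Main.v *)
Require Import Defs.
From HB Require Import structures.
From mathcomp Require Import all_boot all_order all_algebra.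
From mathcomp Require Import all_classical all_reals all_analysis.
From mathcomp Require Import measurable_realfun ring lra.

Set Implicit Arguments.
Unset Strict Implicit.
Unset Printing Implicit Defensive.

Import Order.TTheory GRing.Theory Num.Theory.
Import numFieldNormedType.Exports.

Local Open Scope classical_set_scope.
Local Open Scope ring_scope.

(** Both directions keep the dilation [tau].

    Poincare to isoperimetric: test the Poincare inequality with the indicator of
    [E].  Doubling makes [mu (ball x d)] and [mu (ball y d)] comparable, so the
    energy of the indicator is at most [(1 + Cmu)] times the perimeter of [E].

    Isoperimetric to Poincare: let [E_t] be the set where [u > t] and let [A_t] be
    the set of pairs [(x, y)] separated by [E_t].  By Tonelli,
    [int int |u x - u y| K = int_R (int_(A_t) K) dt] for every kernel [K >= 0].
    With the fractional kernel this bounds the integral of the perimeters of the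
    [E_t] by the energy of [u].  With [K (x, y) = G_n x ^ (q - 1)] on [B * B],
    where [G_n] is the truncation at [n] of [|u - u_B|], Hoelder's inequality on
    [A_t], whose measure in [B * B] is [2 mu (B & E_t) mu (B \ E_t)], bounds the
    L^q mean oscillation of [u] by the integral over [t] of
    [(2 min (mu (B & E_t)) (mu (B \ E_t)) / mu B) ^ (1 / q)].
    Finiteness of the integral of [G_n ^ q] is what allows the division after
    Hoelder, and monotone convergence removes the truncation. *)

(** * Balls in doubling spaces *)

Section metric_balls.
Context {R : realType} {X : completeMetricType R}.
Implicit Types (x y z : X) (r e : R).

Lemma in_ball x r y : ball x r y = (mdist x y < r) :> Prop.
Proof. by rewrite ballEmdist. Qed.

Lemma metric_ball_open x r : open (ball x r).
Proof.
rewrite openE => y; rewrite in_ball => xyr.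
apply/nbhs_ballP; exists (r - mdist x y) => /=; first by rewrite subr_gt0.
move=> z; rewrite !in_ball => yz.
by have := metric_triangle x y z; lra.
Qed.

Lemma sub_ball x y r e : mdist x y + e <= r -> ball y e `<=` ball x r.
Proof.
move=> h z; rewrite !in_ball => yz.
by have := metric_triangle x y z; lra.
Qed.

(** An ultrafilter containing a finite union of balls contains one of them, so total boundedness
    makes every ultrafilter on the closure Cauchy; completeness supplies the limit, and closedness
    keeps it in the closure. *)
Lemma totally_bounded_closure_compact (A : set X) :
  (forall e, 0 < e -> exists s : seq X,
     A `<=` [set x | exists2 y, y \in s & ball y e x]) ->
  compact (closure A).
Proof.
move=> tbA; rewrite compact_ultra => F UF FA.
suff /cauchy_cvg /cvg_ex [p Fp] : cauchy F.
  exists p; split => //.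
  apply: (@closed_closure _ A) => B pB.
  exact: (@filter_ex _ _ (ultra_proper (F := F)) _ (filterI FA (Fp _ pB))).
apply: cauchy_exP => e e0.
(* Half of [e] covers [A]; the other half pays for passing from [A] to its closure. *)
have [s As] := tbA (e / 2) (divr_gt0 e0 (@ltr0Sn R 1)).
have {FA}FA : F [set x | exists2 y, y \in s & ball y e x].
  apply: filterS FA => x /(_ _ (nbhsx_ballx x (PosNum (divr_gt0 e0 (@ltr0Sn R 1)))%:num _)).
  case=> // z [/As [y ys yz] xz]; exists y => //.
  by rewrite (splitr e); apply: ball_triangle yz _; exact: ball_sym.
elim: s {As} FA => [FA|y s IH FA].
  by have [z [? //]] := @filter_ex _ _ (ultra_proper (F := F)) _ FA.
have [Fy|Fy] := in_ultra_setVsetC (ball y e) UF; first by exists y.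
apply: IH; apply: filterS (filterI FA Fy) => x [[w + wx] nyx].
by rewrite inE => /predU1P[ewy|ws]; [case: nyx; rewrite -ewy|exists w].
Qed.

End metric_balls.

Section doubling_geometry.
Context {R : realType} {X : completeMetricType R}.
Variable mu : {outer_measure set X -> \bar R}.
Hypothesis mu_borel : borel_regular mu.
Implicit Types (x y z : X) (r e : R).

Definition doubling_with (Cmu : R) := forall x r, 0 < r ->
  (0 < mu (ball x (2 * r)) /\
   mu (ball x (2 * r)) <= Cmu%:E * mu (ball x r) /\
   Cmu%:E * mu (ball x r) < +oo)%E.

Variable Cmu : R.
Hypothesis Cmu1 : 1 <= Cmu.
Hypothesis mu_doubling : doubling_with Cmu.

(** Positivity is assumed for doubled radii, hence the use of doubling at [r / 2]. *)
Lemma ball_gt0 x r : 0 < r -> (0 < mu (ball x r))%E.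
Proof.
move=> r0; have [+ _] := mu_doubling x (divr_gt0 r0 (@ltr0Sn R 1)).
by rewrite mulrC divfK.
Qed.

Lemma ball_lty x r : 0 < r -> (mu (ball x r) < +oo)%E.
Proof.
move=> r0; have [_ [_ h]] := mu_doubling x r0.
by apply: le_lt_trans h; rewrite lee_pemull// lee_fin.
Qed.

Lemma ball_fin_num x r : 0 < r -> mu (ball x r) \is a fin_num.
Proof. by move=> r0; rewrite ge0_fin_numE ?ball_lty. Qed.

Lemma ball_measurable x r : mu.-cara.-measurable (ball x r).
Proof.
by apply: (mu_borel.1); apply: sub_sigma_algebra; exact: metric_ball_open.
Qed.

Lemma ball_doubling x r : 0 < r ->
  (mu (ball x (2 * r)) <= Cmu%:E * mu (ball x r))%E.
Proof. by move=> r0; have [_ []] := mu_doubling x r0. Qed.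

Lemma ball_doublingX x r n : 0 < r ->
  (mu (ball x (2 ^+ n * r)) <= (Cmu ^+ n)%:E * mu (ball x r))%E.
Proof.
move=> r0; elim: n => [|n IH]; first by rewrite !expr0 mul1r mul1e.
rewrite exprS -mulrA; apply: (le_trans (ball_doubling _ _)).
  by rewrite mulr_gt0// exprn_gt0.
rewrite exprS EFinM -muleA lee_pmul2l//.
by rewrite lte_fin (lt_le_trans ltr01 Cmu1).
Qed.

(** The ball about [y] of radius [mdist x y] lies in the ball about [x] of twice that radius. *)
Lemma ball_comparable x y :
  x != y -> fine (mu (ball y (mdist x y))) <= Cmu * fine (mu (ball x (mdist x y))).
Proof.
rewrite -mdist_gt0 => d0.
rewrite -lee_fin EFinM !fineK ?ball_fin_num//.
apply: le_trans (ball_doubling x d0); apply: le_outer_measure.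
by apply: sub_ball; lra.
Qed.

(** If no finite net exists, a greedy choice yields infinitely many [e]-separated points of the
    ball. The balls of radius [e / 2] about them are disjoint, lie in [ball x (r + e)], and by
    doubling each carries at least a fixed fraction of its measure, which bounds their number. *)
Lemma ball_totally_bounded x r e : 0 < r -> 0 < e -> exists s : seq X,
  ball x r `<=` [set z | exists2 y, y \in s & ball y e z].
Proof.
move=> r0 e0; apply: contrapT => /forallNP nos.
have /choice[f fP] : forall s : seq X, exists y, ball x r y /\
    forall z, z \in s -> e <= mdist z y.
  move=> s; have := nos s; apply: contra_notP => /forallNP h y xy.
  apply: contrapT => hy; apply: (h y); split => // z zs.
  by rewrite leNgt; apply/negP => zy; apply: hy; exists z; rewrite // in_ball.
(* [s n] lists the points chosen before stage [n], and [z n] is the new point, far from all of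
   them. *)
pose s := fix s n := if n is m.+1 then f (s m) :: s m else [::].
pose z n := f (s n).
have zs i j : (i < j)%N -> z i \in s j.
  elim: j => // j IH; rewrite ltnS leq_eqVlt => /predU1P[->|/IH ij].
    by rewrite /= inE eqxx.
  by rewrite /= inE ij orbT.
have zfar i j : (i < j)%N -> e <= mdist (z i) (z j).
  by move=> ij; apply: (fP (s j)).2; exact: zs.
have zx i : mdist x (z i) < r by rewrite -in_ball; exact: (fP (s i)).1.
pose B i : set (caratheodory_type mu) := ball (z i) (e / 2).
have tB : trivIset setT B.
  suff H i j : (i < j)%N -> B i `&` B j !=set0 -> False.
    move=> i j _ _ ij; case: (ltngtP i j) => // ltij; exfalso.
      exact: H ltij ij.
    by apply: H ltij _; rewrite setIC.
  move=> ij [w []]; rewrite /B !in_ball => h1 h2.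
  have := zfar _ _ ij; have := metric_triangle (z i) w (z j).
  by rewrite (metric_sym w); lra.
(* The ball of radius [2 * r + e] about any [z i] contains [ball x (r + e)], so [n] doublings of the
   radius [e / 2] suffice. *)
have [n nP] : exists n, 2 * r + e <= 2 ^+ n * (e / 2).
  pose n := Num.bound ((2 * r + e) / (e / 2)).
  have hn : (2 * r + e) / (e / 2) < n%:R.
    by apply: archi_boundP; rewrite divr_ge0//; lra.
  exists n; rewrite -ler_pdivrMr; last lra.
  apply: (le_trans (ltW hn)); rewrite -natrX ler_nat.
  by apply: ltnW; exact: ltn_expl.
have re0 : 0 < r + e by lra.
have e20 : 0 < e / 2 by lra.
have cB i : fine (mu (ball x (r + e))) <= Cmu ^+ n * fine (mu (B i)).
  rewrite -lee_fin EFinM !fineK ?ball_fin_num//.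
  apply: le_trans (ball_doublingX _ _ e20); apply: le_outer_measure.
  apply: sub_ball; have := zx i; rewrite metric_sym; lra.
pose M := fine (mu (ball x (r + e))).
have M0 : 0 < M by rewrite fine_gt0// ball_gt0// ball_lty.
(* More than [Cmu ^+ n] disjoint balls, each of measure at least [M / Cmu ^+ n], cannot fit into
   measure [M]. *)
pose N := Num.bound (Cmu ^+ n).
have : (\sum_(i < N) mu (B i) <= mu (ball x (r + e)))%E.
  rewrite -[X in (X <= _)%E](@measure_bigsetU _ _ _ (cara_measure mu) B)//.
  - apply: le_outer_measure; rewrite -bigcup_mkord; apply: bigcup_sub => i _.
    by apply: sub_ball; have := zx i; lra.
  - by move=> k; exact: ball_measurable.
have -> : (\sum_(i < N) mu (B i) = (\sum_(i < N) fine (mu (B i)))%:E)%E.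
  by rewrite -sumEFin; apply: eq_bigr => i _; rewrite fineK// ball_fin_num.
rewrite -[mu (ball x _)]fineK ?ball_fin_num// lee_fin -/M => hle.
have Cn0 : 0 < Cmu ^+ n by rewrite exprn_gt0// (lt_le_trans ltr01 Cmu1).
have : \sum_(i < N) M <= Cmu ^+ n * M.
  apply: (@le_trans _ _ (\sum_(i < N) Cmu ^+ n * fine (mu (B i)))).
    by apply: ler_sum => i _; exact: cB.
  by rewrite -mulr_sumr ler_pM2l.
rewrite sumr_const card_ord -mulr_natl ler_pM2r// leNgt => /negP; apply.
by apply: archi_boundP; exact: ltW.
Qed.

(** This makes every ball an admissible set in the definition of [L1loc]. *)
Lemma ball_closure_compact x r : 0 < r -> compact (closure (ball x r)).
Proof.
by move=> r0; apply: totally_bounded_closure_compact => e; exact: ball_totally_bounded.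
Qed.

Lemma L1loc_integrable_ball u x r : 0 < r -> L1loc mu u ->
  (cara_measure mu).-integrable (ball x r) (EFin \o u).
Proof.
by move=> r0; apply; [exact: metric_ball_open|exact: ball_closure_compact].
Qed.

Lemma bounded_compact (A : set X) x : compact A ->
  exists2 r, 0 < r & A `<=` ball x r.
Proof.
rewrite compact_cover => /(_ nat setT (fun n => ball x n.+1%:R)).
case=> [n _|y _|D _ AD]; first exact: metric_ball_open.
  have [n hn] : exists n : nat, mdist x y < n%:R.
    by exists (Num.bound (mdist x y)); apply: archi_boundP; exact: mdist_ge0.
  by exists n => //; rewrite in_ball (lt_trans hn)// ltr_nat.
exists (\max_(n <- finmap.enum_fset D) n).+1%:R => // y /AD [n nD].
rewrite !in_ball => /lt_le_trans; apply; rewrite ler_nat ltnS.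
exact: (@leq_bigmax_seq _ _ xpredT id).
Qed.

(** At each scale the finite nets of the balls about a base point form a countable net of the whole
    space. It serves to write sets of pairs as countable unions of rectangles. *)
Lemma doubling_separable : exists D : nat -> nat -> X,
  forall x k, exists i, ball (D k i) k.+1%:R^-1 x.
Proof.
pose x0 : X := point.
have /choice[s sP] : forall nk : nat * nat, exists s : seq X,
    ball x0 nk.1.+1%:R `<=` [set z | exists2 y, y \in s & ball y nk.2.+1%:R^-1 z].
  by move=> [n k]; apply: ball_totally_bounded; rewrite ?invr_gt0 ltr0n.
(* The index [j] encodes a radius and a position in the corresponding net; the default values only
   add harmless points. *)
exists (fun k j => let ni := odflt (0, 0)%N (unpickle j) in nth x0 (s (ni.1, k)) ni.2).
move=> x k.
have [n hn] : exists n : nat, mdist x0 x < n%:R.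
  by exists (Num.bound (mdist x0 x)); apply: archi_boundP; exact: mdist_ge0.
have [|y ys yx] := sP (n, k) x.
  by rewrite in_ball (lt_trans hn)// ltr_nat.
exists (pickle (n, index y (s (n, k)))).
by rewrite pickleK /= nth_index.
Qed.

End doubling_geometry.

(** * Tonelli and coarea *)

Section nonneg_integrals.
Context d (T : measurableType d) (R : realType).
Variable m : {measure set T -> \bar R}.
Local Open Scope ereal_scope.

(* The integral of a nonnegative function is a supremum over the simple functions
   below it, so monotonicity does not need measurability. *)
Lemma ge0_le_integral_sup (D : set T) (f g : T -> \bar R) :
  (forall x, D x -> 0 <= f x) -> (forall x, D x -> f x <= g x) ->
  \int[m]_(x in D) f x <= \int[m]_(x in D) g x.
Proof.
move=> f0 fg; rewrite !ge0_integralE//; last first.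
  by move=> x Dx; exact: le_trans (f0 _ Dx) (fg _ Dx).
apply: ereal_sup_le => _ [h hf <-]; exists h => //= x.
by apply: (le_trans (hf x)); exact: lee_restrict.
Qed.

End nonneg_integrals.

Section tonelli.
Context d1 d2 (T1 : measurableType d1) (T2 : measurableType d2) (R : realType).
Variables (m1 : {sigma_finite_measure set T1 -> \bar R})
          (m2 : {sigma_finite_measure set T2 -> \bar R}).
Local Open Scope ereal_scope.

Section rectangle.
Variables (f : T1 * T2 -> \bar R) (D1 : set T1) (D2 : set T2).
Hypothesis mf : measurable_fun setT f.
Hypothesis f0 : forall z, 0 <= f z.
Hypothesis mD1 : measurable D1.
Hypothesis mD2 : measurable D2.

Let mfD : measurable_fun setT (f \_ (D1 `*` D2)).
Proof.
apply/(measurable_restrictT _ _).1; first exact: measurableX.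
exact: measurable_funTS.
Qed.

Let fD0 z : 0 <= (f \_ (D1 `*` D2)) z.
Proof. by apply: erestrict_ge0. Qed.

(** Extension of [f] by zero off the rectangle reduces this to Tonelli on the whole product. *)
Lemma integral_rect12 :
  \int[m1]_(x in D1) \int[m2]_(y in D2) f (x, y) =
  \int[m1 \x m2]_(z in D1 `*` D2) f z.
Proof.
rewrite [RHS]integral_mkcond fubini_tonelli1// integral_mkcond.
apply: eq_integral => x _; rewrite /patch; case: ifPn => xD1.
  rewrite integral_mkcond; apply: eq_integral => y _.
  by rewrite /patch in_setX/= xD1.
rewrite /fubini_F integral0_eq// => y _.
by rewrite /patch in_setX/= (negbTE xD1).
Qed.

Lemma integral_rect21 :
  \int[m2]_(y in D2) \int[m1]_(x in D1) f (x, y) =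
  \int[m1 \x m2]_(z in D1 `*` D2) f z.
Proof.
rewrite [RHS]integral_mkcond fubini_tonelli2// integral_mkcond.
apply: eq_integral => y _; rewrite /patch; case: ifPn => yD2.
  rewrite integral_mkcond; apply: eq_integral => x _.
  by rewrite /patch in_setX/= yD2 andbT.
rewrite /fubini_G integral0_eq// => x _.
by rewrite /patch in_setX/= (negbTE yD2) andbF.
Qed.

End rectangle.

End tonelli.

(* Every integral of the theorem is taken with respect to a bare measure, while
   Tonelli's theorem expects a sigma-finite structure. *)
Section as_sigma_finite.
Context d (T : measurableType d) (R : realType).
Variable m : {measure set T -> \bar R}.
Hypothesis sf : sigma_finite setT m.
Definition as_sigma_finite of sigma_finite setT m : set T -> \bar R := m.

HB.instance Definition _ := Measure.copy (as_sigma_finite sf) m.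
HB.instance Definition _ :=
  Measure_isSigmaFinite.Build _ _ _ (as_sigma_finite sf) sf.

End as_sigma_finite.

(** Products of two increasing exhaustions exhaust the product: stages [i] and [j] meet at
    [maxn i j]. The coarea formula is applied to this product measure. *)
Lemma sigma_finite_prod d1 d2 (T1 : measurableType d1) (T2 : measurableType d2) (R : realType)
    (m1 : {sigma_finite_measure set T1 -> \bar R})
    (m2 : {sigma_finite_measure set T2 -> \bar R}) :
  sigma_finite setT (m1 \x m2)%E.
Proof.
have /sigma_finiteP[F [TF ndF Foo]] := sigma_finiteT m1.
have /sigma_finiteP[G [TG ndG Goo]] := sigma_finiteT m2.
exists (fun n => F n `*` G n).
  apply/esym/seteqP; split => // -[x y] _.
  have [i _ Fix] : (\bigcup_k F k) x by rewrite -TF.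
  have [j _ Gjy] : (\bigcup_k G k) y by rewrite -TG.
  exists (maxn i j) => //; split => /=.
    by apply: (subsetPset _ _ (ndF _ _ (leq_maxl i j))).
  by apply: (subsetPset _ _ (ndG _ _ (leq_maxr i j))).
move=> k; have [mFk Fk] := Foo k; have [mGk Gk] := Goo k.
split; first exact: measurableX.
by rewrite product_measure1E// lte_mul_pinfty// ge0_fin_numE.
Qed.

Section coarea.
Context d (T : measurableType d) (R : realType).
Variable m : {measure set T -> \bar R}.
Hypothesis sfm : sigma_finite setT m.
Variables (a b : T -> R).
Hypothesis ma : measurable_fun setT a.
Hypothesis mb : measurable_fun setT b.

(** With one strict and one weak inequality, these are the points where exactly one of [a] and [b]
    exceeds [t]. *)
Definition between (t : R) : set T :=
  [set z | (Order.min (a z) (b z) <= t) && (t < Order.max (a z) (b z))].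

Let S : set (T * measurableTypeR R) :=
  [set p | (Order.min (a p.1) (b p.1) <= p.2) && (p.2 < Order.max (a p.1) (b p.1))].

Let mS : measurable S.
Proof.
have ma1 : measurable_fun setT (fun p : T * measurableTypeR R => a p.1).
  exact: measurableT_comp.
have mb1 : measurable_fun setT (fun p : T * measurableTypeR R => b p.1).
  exact: measurableT_comp.
have m2 : measurable_fun setT (fun p : T * measurableTypeR R => p.2 : R).
  exact: measurable_snd.
rewrite /S -[X in measurable X]setTI -[X in _ `&` X]preimage_true.
apply: measurable_and => //.
- by apply: measurable_fun_ler => //; exact: measurable_minr.
- by apply: measurable_fun_ltr => //; exact: measurable_maxr.
Qed.

Lemma measurable_between t : measurable (between t).
Proof.
have -> : between t = ysection S t by apply/seteqP; split => z /=; rewrite /ysection /= inE.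
exact: measurable_ysection.
Qed.

Lemma coarea (K : T -> \bar R) : measurable_fun setT K -> (forall z, 0 <= K z)%E ->
  (\int[m]_z (`|a z - b z|%:E * K z) =
   \int[lebesgue_measure]_t \int[m]_(z in between t) K z)%E.
Proof.
move=> mK K0.
pose f (p : T * measurableTypeR R) := ((\1_S p)%:E * K p.1)%E.
have mf : measurable_fun setT f.
  apply: emeasurable_funM; last exact: measurableT_comp.
  by apply/measurable_EFinP; exact: measurable_indic.
have f0 p : (0 <= f p)%E by rewrite mule_ge0// lee_fin.
have : (\int[m]_x \int[lebesgue_measure]_y f (x, y) =
    \int[lebesgue_measure]_y \int[m]_x f (x, y))%E.
  exact: (@fubini_tonelli _ _ _ _ R (as_sigma_finite sfm) (@lebesgue_measure R) f).
have -> : (\int[m]_x \int[lebesgue_measure]_y f (x, y) =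
    \int[m]_z (`|a z - b z|%:E * K z))%E.
  apply: eq_integral => x _; rewrite /f /=.
  have E t : \1_S (x, t) = \1_(xsection S x) t :> R.
    by rewrite !indicE mem_xsection.
  under eq_integral => t _ do rewrite E.
  rewrite ge0_integralZr//; last first.
    by apply/measurable_EFinP/measurable_indic; exact: measurable_xsection.
  congr (_ * _)%E; rewrite integral_indic ?setIT//; last exact: measurable_xsection.
  have -> : xsection S x = `[Order.min (a x) (b x), Order.max (a x) (b x)[%classic.
    by apply/seteqP; split => t; rewrite /xsection /= in_itv /= inE.
  rewrite [LHS](lebesgue_measure_itv `[_, _[) /= lte_fin -EFinD.
  case: (ltgtP (a x) (b x)) => [ab|ab|->].
  - by rewrite ab ltr0_norm ?subr_lt0// opprB.
  - by rewrite ab gtr0_norm ?subr_gt0.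
  - by rewrite ltxx subrr normr0.
move=> ->.
apply: eq_integral => t _; rewrite [RHS]integral_mkcond; apply: eq_integral => z _.
rewrite /f patchE indicE /=.
have -> : ((z, t) \in S) = (z \in between t) by [].
by case: ifPn => _; rewrite ?mul1e ?mul0e.
Qed.

End coarea.

(** * Mean oscillation and level sets *)

Section hoelder_on_sets.
Context d (T : measurableType d) (R : realType).
Variable m : {measure set T -> \bar R}.

(** Hoelder's inequality for [g ^ (q - 1)] on [D] and the indicator of [C], with conjugate exponents
    [q / (q - 1)] and [q]. The case [q = 1], where the first exponent would be infinite, is an
    equality treated apart. *)
Lemma hoelder_set (C D : set T) (g : T -> R) (q : R) :
  measurable C -> measurable D -> C `<=` D ->
  measurable_fun setT g -> (forall z, 0 <= g z) -> 1 <= q ->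
  (\int[m]_(z in C) (g z `^ (q - 1))%:E <=
   (\int[m]_(z in D) (g z `^ q)%:E) `^ (1 - q^-1) * m C `^ q^-1)%E.
Proof.
move=> mC mD CD mg g0; rewrite le_eqVlt => /predU1P[<-|q1].
  rewrite subrr invr1 subrr poweRe0 mul1e poweRe1//.
  by under eq_integral do rewrite powRr0; rewrite integral_cst// mul1e.
have q0 : 0 < q by rewrite (lt_trans _ q1).
have q10 : 0 < q - 1 by rewrite subr_gt0.
pose p := q / (q - 1).
have p0 : 0 < p by rewrite divr_gt0.
have pV : p^-1 = 1 - q^-1 by rewrite invf_div mulrBl divff ?gt_eqF// div1r.
have pq : p^-1 + q^-1 = 1 by rewrite pV subrK.
pose f z := g z `^ (q - 1) * \1_D z; pose h : T -> R := \1_C.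
have mf : measurable_fun setT f.
  apply: measurable_funM; last exact: measurable_indic.
  exact: (measurableT_comp (measurable_powR _)).
have mh : measurable_fun setT h by exact: measurable_indic.
have := hoelder m mf mh p0 q0 pq.
rewrite Lnorm1 unlock pV /=.
have -> : (\int[m]_z `|((f \* h) z)%:E| = \int[m]_(z in C) (g z `^ (q - 1))%:E)%E.
  rewrite [RHS]integral_mkcond; apply: eq_integral => z _.
  rewrite /= /f /h !indicE patchE; case: ifPn => zC.
    have -> : z \in D by rewrite inE; apply: CD; rewrite inE in zC.
    by rewrite !mulr1 ger0_norm ?powR_ge0.
  by rewrite mulr0 normr0.
have -> : (\int[m]_z (`|(f z)%:E| `^ p) = \int[m]_(z in D) (g z `^ q)%:E)%E.
  rewrite [RHS]integral_mkcond; apply: eq_integral => z _.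
  rewrite /f indicE patchE; case: ifPn => zD.
    rewrite mulr1 abse_EFin ger0_norm ?powR_ge0// poweR_EFin -powRrM.
    by rewrite /p mulrCA divff ?gt_eqF// mulr1.
  by rewrite mulr0 abse0 poweR0r// gt_eqF.
have -> : (\int[m]_z (`|(h z)%:E| `^ q) = m C)%E.
  rewrite -[C in RHS]setIT -[RHS](integral_indic m measurableT mC)//.
  apply: eq_integral => z _; rewrite /h indicE.
  case: (z \in C); first by rewrite abse_EFin normr1 poweR1r.
  by rewrite abse0 poweR0r// gt_eqF.
by [].
Qed.

End hoelder_on_sets.

(** Division by [s ^ (1 - q^-1)], legitimate because [s] is real; [s = 0] is trivial, and [I] may be
    infinite. *)
Lemma poweR_absorb (R : realType) (s q : R) (I : \bar R) :
  0 <= s -> 1 <= q -> (0 <= I)%E ->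
  (s%:E <= s%:E `^ (1 - q^-1) * I -> s%:E `^ q^-1 <= I)%E.
Proof.
move=> s0 q1 I0; have q0 : 0 < q by rewrite (lt_le_trans _ q1).
have qV0 : q^-1 != 0 by rewrite invr_eq0 gt_eqF.
have [->|sn0] := eqVneq s 0; first by move=> _; rewrite poweR0r.
have {s0 sn0} s0 : 0 < s by rewrite lt_def sn0.
have E : s = s `^ (1 - q^-1) * s `^ q^-1.
  by rewrite -powRD ?subrK ?powRr1 ?(ltW s0)// oner_eq0.
rewrite {1}E EFinM poweR_EFin lee_pmul2l// lte_fin powR_gt0//.
Qed.

(** A product is its smaller factor times its larger one, and the larger is at most [b]. *)
Lemma mulee_le_mine (R : realType) (x y : \bar R) (b : R) :
  (0 <= x -> 0 <= y -> x <= b%:E -> y <= b%:E ->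
   x * y + x * y <= (2 * b)%:E * mine x y)%E.
Proof.
case: x y => [x| |] [y| |]//; rewrite !lee_fin => x0 y0 xb yb.
rewrite -!EFinM -EFinD -EFin_min -EFinM lee_fin.
by case: (leP x y) => xy; nra.
Qed.

Section mean_oscillation.
Context d (T : measurableType d) (R : realType).
Variable m : {sigma_finite_measure set T -> \bar R}.
Variables (u : T -> R) (B : set T) (q : R).
Hypothesis mB : measurable B.
Hypothesis B0 : (0 < m B)%E.
Hypothesis Boo : (m B < +oo)%E.
Hypothesis meas_u : measurable_fun setT u.
Hypothesis iu : m.-integrable B (EFin \o u).
Hypothesis q1 : 1 <= q.

Let b := fine (m B).
Let mean := b^-1 * \int[m]_(x in B) u x.
Let E (t : R) := [set x | t < u x].
Let W (t : R) : \bar R := mine (m (B `&` E t)) (m (B `\` E t)).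

Let bE : m B = b%:E.
Proof. by rewrite fineK// ge0_fin_numE. Qed.

Let b0 : 0 < b.
Proof. by rewrite fine_gt0// B0. Qed.

Let q0 : 0 < q. Proof. by rewrite (lt_le_trans _ q1). Qed.

Let mE t : measurable (E t).
Proof.
rewrite -[E t]setTI.
have mlt := measurable_fun_ltr (measurable_cst t) meas_u.
by have := mlt measurableT [set true] Logic.I.
Qed.

(** The difference [u x - mean] is the average over [y] in [B] of [u x - u y]. *)
Lemma dist_mean_le x :
  (`|u x - mean|%:E <= b^-1%:E * \int[m]_(y in B) (`|u x - u y|)%:E)%E.
Proof.
have icst : m.-integrable B (EFin \o cst (u x)).
  apply/integrableP; split; first by apply/measurable_EFinP; exact: measurable_cst.
  by rewrite (_ : (fun _ => _) = cst `|u x|%:E)// integral_cst// lte_mul_pinfty.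
have iux : m.-integrable B (EFin \o (fun y => u x - u y)).
  exact: (integrableB mB icst iu).
have -> : u x - mean = b^-1 * \int[m]_(y in B) (u x - u y).
  rewrite RintegralB// Rintegral_cst// -/b mulrBr mulrCA mulVf ?gt_eqF//.
  by rewrite mulr1.
rewrite normrM gtr0_norm ?invr_gt0// EFinM lee_pmul2l ?lte_fin ?invr_gt0//.
have iux' : m.-integrable B (EFin \o (fun y => `|u x - u y|)).
  exact: integrable_norm.
rewrite -[leRHS]fineK; last exact: integrable_fin_num iux'.
by rewrite lee_fin; exact: le_normr_Rintegral.
Qed.

(** A separated pair has one point in [E t] and the other outside, which leaves two rectangles, one
    for each order. *)
Lemma measure_between_le t :
  ((m \x m)%E (between (u \o fst) (u \o snd) t `&` (B `*` B)) <=
   (2 * b)%:E * W t)%E.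
Proof.
have mBE : measurable (B `&` E t) by exact: measurableI.
have mBD : measurable (B `\` E t) by exact: measurableD.
have mbt : measurable (between (u \o fst) (u \o snd) t).
  by apply: measurable_between; exact: measurableT_comp.
apply: (@le_trans _ _ ((m \x m)%E (((B `&` E t) `*` (B `\` E t)) `|`
    ((B `\` E t) `*` (B `&` E t))))).
  apply: le_measure; rewrite ?inE.
  - by apply: measurableI => //; exact: measurableX.
  - by apply: measurableU; exact: measurableX.
  - move=> [x y] [/= /andP[]]; rewrite ge_min lt_max => h1 h2 [Bx By].
    have [tx|tx] := ltP t (u x); [left|right].
      by split => //; split => //; rewrite /E /= => ty; move: h1; rewrite !leNgt tx ty.
    split; split => //; last by move: h2; rewrite ltNge tx.
    by rewrite /E /= ltNge tx.
apply: (le_trans (measureU2 _ _ _)); [exact: measurableX|exact: measurableX|].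
rewrite [X in (X + _)%E]product_measure1E// [X in (_ + X)%E]product_measure1E//.
rewrite [X in (_ + X)%E]muleC.
have le_b (C : set T) : C `<=` B -> measurable C -> (m C <= b%:E)%E.
  by move=> CB mC; rewrite -bE; apply: le_measure; rewrite ?inE.
by apply: mulee_le_mine => //; apply: le_b.
Qed.

(** Both terms of the minimum are measures of sections at [t] of measurable sets of pairs
    [(t, x)]. *)
Lemma measurable_levelmin : measurable_fun setT (W : measurableTypeR R -> \bar R).
Proof.
have ms : measurable_fun setT (fun p : measurableTypeR R * T => p.1 < u p.2).
  apply: measurable_fun_ltr; first exact: measurable_fst.
  by apply: measurableT_comp => //; exact: measurable_snd.
pose S1 := [set p : measurableTypeR R * T | B p.2 /\ p.1 < u p.2].
pose S2 := [set p : measurableTypeR R * T | B p.2 /\ ~ (p.1 < u p.2)].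
have mB2 : measurable [set p : measurableTypeR R * T | B p.2].
  by rewrite -[X in measurable X]setTI; exact: measurable_snd.
have mlt : measurable [set p : measurableTypeR R * T | p.1 < u p.2].
  rewrite -[X in measurable X]setTI.
  by have := ms measurableT [set true] Logic.I.
have mS1 : measurable S1 by exact: measurableI.
have mS2 : measurable S2 by exact: (measurableD mB2 mlt).
have -> : (W : measurableTypeR R -> \bar R) =
    (fun t => mine (m (xsection S1 t)) (m (xsection S2 t))).
  by apply/funext => t; congr (mine (m _) (m _));
    apply/seteqP; split => x; rewrite /xsection /= inE.
by apply: measurable_mine; exact: measurable_fun_xsection.
Qed.

Let G x : R := `|u x - mean|.
Let Gn n x : R := Order.min (G x) n%:R.

Let mG : measurable_fun setT G.
Proof. by apply: measurableT_comp => //; exact: measurable_funB. Qed.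

Let mGn n : measurable_fun setT (Gn n).
Proof. exact: measurable_minr. Qed.

Let Gn0 n x : 0 <= Gn n x. Proof. by rewrite le_min normr_ge0/=. Qed.

(** The factor 2 under the root counts the two orders in which a pair can be separated. *)
Let J := (\int[lebesgue_measure]_t (2%:E * (W t * b^-1%:E)) `^ q^-1)%E.

Lemma truncated_oscillation n :
  (b^-1%:E * \int[m]_(x in B) (Gn n x `^ q)%:E <= J `^ q)%E.
Proof.
pose M := (m \x m)%E.
pose BB := B `*` B.
have mBB : measurable BB by exact: measurableX.
pose Wb (t : measurableTypeR R) : \bar R := ((2 * b)%:E * W t)%E.
have W0 t : (0 <= W t)%E by rewrite le_min !measure_ge0.
have Wb0 t : (0 <= Wb t)%E by rewrite mule_ge0// lee_fin mulr_ge0// ltW.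
have mWb : measurable_fun setT Wb.
  by apply: emeasurable_funM => //; exact: measurable_levelmin.
have mWbq : measurable_fun setT (fun t => Wb t `^ q^-1)%E.
  exact: (measurableT_comp (measurable_poweR _)).
pose I := (\int[lebesgue_measure]_t (Wb t) `^ q^-1)%E.
have I0 : (0 <= I)%E by apply: integral_ge0 => t _; exact: poweR_ge0.
have mGq r : measurable_fun setT (fun x => Gn n x `^ r).
  exact: (measurableT_comp (measurable_powR _)).
(* Finite because [Gn n] is at most [n] and [B] has finite measure. *)
have [s Ss] : exists s, (\int[m]_(x in B) (Gn n x `^ q)%:E)%E = s%:E.
  exists (fine (\int[m]_(x in B) (Gn n x `^ q)%:E)%E); rewrite fineK//.
  rewrite ge0_fin_numE; last by apply: integral_ge0 => x _; rewrite lee_fin powR_ge0.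
  apply: (@le_lt_trans _ _ (\int[m]_(x in B) (cst (n%:R `^ q)%:E x))%E).
    apply: ge0_le_integral_sup => x _; first by rewrite lee_fin powR_ge0.
    by rewrite lee_fin ge0_ler_powR ?(ltW q0) ?nnegrE// /Gn ge_min lexx orbT.
  by rewrite integral_cst// lte_mul_pinfty// lee_fin powR_ge0.
have s0 : 0 <= s.
  by rewrite -lee_fin -Ss; apply: integral_ge0 => x _; rewrite lee_fin powR_ge0.
have SM : (\int[M]_(z in BB) (Gn n z.1 `^ q)%:E = (b * s)%:E)%E.
  rewrite -(@integral_rect12 _ _ _ _ _ m m (fun z => (Gn n z.1 `^ q)%:E))//; last 2 first.
    - apply/measurable_EFinP; exact: (measurableT_comp (mGq q)).
    - by move=> z; rewrite lee_fin powR_ge0.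
  rewrite EFinM -Ss -ge0_integralZl_EFin ?(ltW b0)//.
  - apply: eq_integral => x _; rewrite muleC -bE /=.
    exact: (@integral_cst _ _ _ m B mB (Gn n x `^ q)%:E).
  - by move=> x _; rewrite lee_fin powR_ge0.
  - by apply/measurable_EFinP; exact: measurable_funTS.
(* One factor of [Gn n x ^ q] is bounded by [|u x - mean|], and [b] times that by the integral of
   [|u x - u y|] over [y]. *)
have step1 : ((b * s)%:E <= \int[M]_(z in BB)
    (`|u z.1 - u z.2|%:E * (Gn n z.1 `^ (q - 1))%:E))%E.
  rewrite -(@integral_rect12 _ _ _ _ _ m m
    (fun z => (`|u z.1 - u z.2|%:E * (Gn n z.1 `^ (q - 1))%:E)%E))//; last 2 first.
  - apply: emeasurable_funM; apply/measurable_EFinP.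
    + apply: measurableT_comp => //; apply: measurable_funB.
        exact: (measurableT_comp meas_u).
      exact: (measurableT_comp meas_u).
    + exact: (measurableT_comp (mGq _)).
  - by move=> z; rewrite mule_ge0// lee_fin// powR_ge0.
  rewrite EFinM -Ss -ge0_integralZl_EFin ?(ltW b0)//; last 2 first.
  - by move=> x _; rewrite lee_fin powR_ge0.
  - by apply/measurable_EFinP; exact: measurable_funTS.
  apply: ge0_le_integral_sup => x _ /=.
    by rewrite mule_ge0// lee_fin ?powR_ge0// ltW.
  rewrite ge0_integralZr//; last 2 first.
  - apply/measurable_EFinP; apply: measurable_funTS.
    by apply: measurableT_comp => //; exact: measurable_funB.
  - by rewrite lee_fin powR_ge0.
  rewrite -(mulr_powRB1 (Gn0 n x) q0) EFinM muleA.
  apply: lee_wpmul2r; first by rewrite lee_fin powR_ge0.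
  apply: (@le_trans _ _ (b%:E * `|u x - mean|%:E)%E).
    by rewrite lee_pmul2l// lee_fin /Gn ge_min lexx.
  have := dist_mean_le x; rewrite -(@lee_pmul2l _ b%:E)//.
  by rewrite muleA -[X in (_ <= X * _)%E]EFinM mulfV ?gt_eqF// mul1e.
pose K (z : T * T) := (Gn n z.1 `^ (q - 1))%:E.
have K0 z : (0 <= K z)%E by rewrite lee_fin powR_ge0.
(* Coarea with kernel [K] cut off to [BB], then Hoelder on each set of separated pairs, whose
   measure is at most [Wb t]. *)
have step2 : ((b * s)%:E <= (b * s)%:E `^ (1 - q^-1) * I)%E.
  apply: (le_trans step1); rewrite integral_mkcond.
  rewrite (eq_integral (fun z => `|(u \o fst) z - (u \o snd) z|%:E * (K \_ BB) z)%E);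
    last first.
    by move=> z _; rewrite !patchE; case: ifPn => // _; rewrite mule0.
  rewrite (@coarea _ _ _ (m \x m)%E (sigma_finite_prod m m) (u \o fst) (u \o snd)); first last.
  - by move=> z; exact: erestrict_ge0.
  - apply/(measurable_restrictT _ _).1 => //; apply: measurable_funTS.
    by apply/measurable_EFinP; exact: (measurableT_comp (mGq _)).
  - exact: measurableT_comp.
  - exact: measurableT_comp.
  rewrite /I -ge0_integralZl_EFin ?powR_ge0//; last first.
    by move=> t _; exact: poweR_ge0.
  apply: ge0_le_integral_sup => t _.
    by apply: integral_ge0 => z _; exact: erestrict_ge0.
  rewrite -integral_mkcondr.
  apply: (le_trans (@hoelder_set _ _ _ _ _ BB (fun z => Gn n z.1) q _ _ _ _ _ q1)) => //.
  - apply: measurableI => //.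
    by apply: measurable_between; exact: measurableT_comp.
  - exact: (measurableT_comp (mGn n)).
  rewrite SM poweR_EFin lee_wpmul2l ?lee_fin ?powR_ge0//.
  apply: gt0_ler_poweR; rewrite ?invr_ge0 ?(ltW q0) ?in_itv/= ?leey ?andbT//.
  exact: measure_between_le.
have {}step2 := poweR_absorb (mulr_ge0 (ltW b0) s0) q1 I0 step2.
(* [I] uses unnormalised measures of pairs in [B * B]; dividing by [b ^ 2] under the root gives
   [J]. *)
have JE : J = (((b ^- 2) `^ q^-1)%:E * I)%E.
  rewrite /J /I -ge0_integralZl_EFin ?powR_ge0//; last first.
    by move=> t _; exact: poweR_ge0.
  apply: eq_integral => t _; rewrite -poweR_EFin -poweRM ?lee_fin ?invr_ge0 ?exprn_ge0 ?(ltW b0)//.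
  congr (_ `^ _)%E; rewrite /Wb (muleC (W t)) !muleA -!EFinM.
  congr (_%:E * _)%E; by rewrite expr2 invfM mulrCA -mulrA mulVf ?gt_eqF// mulr1.
rewrite JE poweRM ?lee_fin ?powR_ge0// poweR_EFin -powRrM mulVf ?gt_eqF//.
rewrite powRr1 ?invr_ge0 ?exprn_ge0 ?(ltW b0)// Ss.
apply: (@le_trans _ _ ((b ^- 2)%:E * (b * s)%:E)%E).
  by rewrite -!EFinM lee_fin expr2 invfM mulrA mulfVK// gt_eqF.
apply: lee_wpmul2l; first by rewrite lee_fin invr_ge0 exprn_ge0// ltW.
have : (((b * s)%:E `^ q^-1) `^ q <= I `^ q)%E.
  apply: gt0_ler_poweR => //; first exact: ltW.
  - by rewrite in_itv/= leey andbT lee_fin powR_ge0.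
  - by rewrite in_itv/= leey andbT.
by rewrite -poweRrM mulVf ?gt_eqF// poweRe1// lee_fin mulr_ge0// ltW.
Qed.

Lemma mean_oscillation_le :
  ((b^-1%:E * \int[m]_(x in B) (G x `^ q)%:E) `^ q^-1 <= J)%E.
Proof.
have J0 : (0 <= J)%E by apply: integral_ge0 => t _; exact: poweR_ge0.
suff H : (b^-1%:E * \int[m]_(x in B) (G x `^ q)%:E <= J `^ q)%E.
  have : ((b^-1%:E * \int[m]_(x in B) (G x `^ q)%:E) `^ q^-1 <= (J `^ q) `^ q^-1)%E.
    apply: gt0_ler_poweR => //; first by rewrite invr_ge0 ltW.
    - rewrite in_itv/= leey andbT mule_ge0 ?lee_fin ?invr_ge0 ?(ltW b0)//.
      by apply: integral_ge0 => x _; rewrite lee_fin powR_ge0.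
    - by rewrite in_itv/= leey andbT poweR_ge0.
  by rewrite -poweRrM mulfV ?gt_eqF// poweRe1.
(* At each point the truncations equal [G x] as soon as [n] exceeds it. *)
have -> : (\int[m]_(x in B) (G x `^ q)%:E =
    \int[m]_(x in B) limn (fun n => (Gn n x `^ q)%:E))%E.
  apply: eq_integral => x _; apply/esym/cvg_lim => //.
  apply: cvg_near_cst; near=> n; congr (_ `^ q)%:E.
  rewrite /Gn min_l//; near: n; exact: nbhs_infty_ger.
rewrite monotone_convergence//; first last.
- move=> x _ i j ij; rewrite lee_fin ge0_ler_powR ?(ltW q0) ?nnegrE//.
  by rewrite /Gn le_min ge_min lexx ge_min ler_nat ij orbT.
- by move=> n x _; rewrite lee_fin powR_ge0.
- move=> n; apply/measurable_EFinP; apply: measurable_funTS.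
  exact: (measurableT_comp (measurable_powR _)).
rewrite -limeMl//; last first.
  apply: ereal_nondecreasing_is_cvgn => i j ij; apply: ge0_le_integral_sup.
    by move=> x _; rewrite lee_fin powR_ge0.
  move=> x _; rewrite lee_fin ge0_ler_powR ?(ltW q0) ?nnegrE//.
  by rewrite /Gn le_min ge_min lexx ge_min ler_nat ij orbT.
apply: lime_le; last by apply: nearW => n; exact: truncated_oscillation.
apply: is_cvgeMl => //.
apply: ereal_nondecreasing_is_cvgn => i j ij; apply: ge0_le_integral_sup.
  by move=> x _; rewrite lee_fin powR_ge0.
move=> x _; rewrite lee_fin ge0_ler_powR ?(ltW q0) ?nnegrE//.
by rewrite /Gn le_min ge_min lexx ge_min ler_nat ij orbT.
Unshelve. all: by end_near.
Qed.

End mean_oscillation.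

(** * Kernels *)

(** For nonnegative values the inverse is the power of exponent -1, also at 0, where both are 0. *)
Lemma measurable_fun_inv (R : realType) (d : measure_display) (T : measurableType d) (f : T -> R) :
  (forall x, 0 <= f x) -> measurable_fun setT f ->
  measurable_fun setT (fun x => (f x)^-1).
Proof.
move=> f0 mf; have := measurableT_comp (measurable_powR (-1)) mf.
by congr measurable_fun; apply/funext => x /=; rewrite powR_inv1.
Qed.

Section kernels.
Context {R : realType} {X : completeMetricType R}.
Variable mu : {outer_measure set X -> \bar R}.
Hypothesis mu_borel : borel_regular mu.
Variable Cmu : R.
Hypothesis Cmu1 : 1 <= Cmu.
Hypothesis mu_doubling : doubling_with mu Cmu.
Implicit Types (x y : X) (r theta : R).

Local Notation cT := (caratheodory_type mu).

Lemma cara_sigma_finite : sigma_finite setT (cara_measure mu).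
Proof.
exists (fun n => ball (point : X) n.+1%:R : set cT).
  apply/esym/seteqP; split => // x _.
  exists (Num.bound (mdist (point : X) x)) => //; rewrite in_ball.
  apply: (@lt_trans _ _ (Num.bound (mdist (point : X) x))%:R).
    by apply: archi_boundP; exact: mdist_ge0.
  by rewrite ltr_nat.
move=> n; split; first exact: ball_measurable.
exact: (ball_lty Cmu1 mu_doubling).
Qed.

(** The same set function as [cara_measure mu], so integrals against the two are convertible. *)
Definition cara_sigma : {sigma_finite_measure set cT -> \bar R} :=
  as_sigma_finite cara_sigma_finite.

(** The product sigma-algebra is generated by rectangles, so [mdist x y < t] is written as a
    countable union of products of balls about net points [D k i]. *)
Lemma measurable_mdist :
  measurable_fun setT (fun z : cT * cT => mdist (z.1 : X) (z.2 : X)).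
Proof.
have [D DP] := doubling_separable mu_borel Cmu1 mu_doubling.
move=> _; apply: (measurability _ (RGenInftyO.measurableE R)) => //.
move=> _ [_ [t ->] <-]; rewrite setTI.
pose F k i : set (cT * cT) :=
  (ball (D k i) k.+1%:R^-1 : set cT) `*` (ball (D k i) (t - k.+1%:R^-1) : set cT).
rewrite (_ : _ @^-1` _ = \bigcup_k \bigcup_i F k i); last first.
  apply/seteqP; split => [[x y]|[x y] [k _ [i _ []]]] /=; last first.
    rewrite !in_ball in_itv/= => Dx Dy.
    have := metric_triangle x (D k i) y; rewrite (metric_sym x (D k i)) => tri.
    apply: (le_lt_trans tri); rewrite -(subrKC k.+1%:R^-1 t); exact: ltrD.
  rewrite in_itv/= => xyt.
  (* One [k.+1%:R^-1] is lost in moving from [x] to the net point, the other in the radius of the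
     second ball. *)
  have [k hk] : exists k : nat, 2 * k.+1%:R^-1 < t - mdist x y.
    have e0 : 0 < (t - mdist x y) / 2 by lra.
    have [k] := @ltr_add_invr R 0 ((t - mdist x y) / 2) e0.
    by rewrite add0r => hk; exists k; move: (_^-1) hk => e; lra.
  have [i Di] := DP x k; exists k => //; exists i => //; split => //=.
  move: Di; rewrite !in_ball => Di.
  have := metric_triangle (D k i) x y; move: (k.+1%:R^-1) hk Di => e; lra.
apply: bigcupT_measurable => k; apply: bigcupT_measurable => i.
by apply: measurableX; exact: ball_measurable.
Qed.

(** The ball is the section at [(x, y)] of the measurable set [S] of triples. *)
Lemma measurable_ball_measure : measurable_fun setT
  (fun z : cT * cT => mu (ball (z.1 : X) (mdist (z.1 : X) (z.2 : X)))).
Proof.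
pose S := [set p : (cT * cT) * cT | mdist (p.1.1 : X) p.2 < mdist (p.1.1 : X) p.1.2].
have mS : measurable S.
  have h : measurable_fun setT (fun p : (cT * cT) * cT =>
      mdist (p.1.1 : X) p.2 < mdist (p.1.1 : X) p.1.2).
    apply: measurable_fun_ltr.
      have mp : measurable_fun setT (fun p : (cT * cT) * cT => (p.1.1, p.2) : cT * cT).
        apply: measurable_fun_pair; last exact: measurable_snd.
        exact: (measurableT_comp measurable_fst measurable_fst).
      exact: (measurableT_comp measurable_mdist mp).
    exact: (measurableT_comp measurable_mdist measurable_fst).
  by have := h measurableT [set true] Logic.I; rewrite setTI.
have := measurable_fun_xsection cara_sigma mS.
congr measurable_fun; apply/funext => -[x y] /=.
rewrite -[LHS]/(mu (xsection S (x, y))); congr (mu _).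
by apply/seteqP; split => z; rewrite in_ball /xsection /= inE.
Qed.

Lemma fine_ball_gt0 x y : x != y -> 0 < fine (mu (ball x (mdist x y))).
Proof.
rewrite -mdist_gt0 => d0; rewrite fine_gt0//.
by rewrite (ball_gt0 mu_doubling)// (ball_lty Cmu1 mu_doubling).
Qed.

Lemma fine_ball_ge0 x r : 0 <= fine (mu (ball x r)).
Proof. by rewrite fine_ge0. Qed.

Lemma measurable_fine_ball : measurable_fun setT
  (fun z : cT * cT => fine (mu (ball (z.1 : X) (mdist (z.1 : X) (z.2 : X))))).
Proof.
exact: (measurableT_comp (fine_measurable measurableT) measurable_ball_measure).
Qed.

Lemma measurable_fine_ball_swap : measurable_fun setT
  (fun z : cT * cT => fine (mu (ball (z.2 : X) (mdist (z.1 : X) (z.2 : X))))).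
Proof.
have := measurableT_comp measurable_fine_ball (@measurable_swap _ _ cT cT).
by congr measurable_fun; apply/funext => -[x y] /=; rewrite metric_sym.
Qed.

(** The weight of [|u x - u y|] in [poincare_kernel]. On the diagonal it is 0, because [ball x 0] is
    empty and the inverse of 0 is 0. *)
Definition half_kernel theta (z : cT * cT) : R :=
  (mdist (z.1 : X) (z.2 : X) `^ theta *
   fine (mu (ball (z.1 : X) (mdist (z.1 : X) (z.2 : X)))))^-1.

Lemma half_kernel_ge0 theta z : 0 <= half_kernel theta z.
Proof. by rewrite invr_ge0 mulr_ge0 ?powR_ge0 ?fine_ball_ge0. Qed.

Lemma poincare_kernelE theta u x y :
  poincare_kernel mu theta u x y = `|u x - u y| * half_kernel theta (x, y).
Proof. by []. Qed.

Lemma measurable_half_kernel theta : measurable_fun setT (half_kernel theta).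
Proof.
apply: measurable_fun_inv; first by move=> z; rewrite mulr_ge0 ?powR_ge0 ?fine_ball_ge0.
apply: measurable_funM; last exact: measurable_fine_ball.
exact: (measurableT_comp (measurable_powR _) measurable_mdist).
Qed.

Lemma perimeter_kernel_ge0 theta x y : 0 <= perimeter_kernel mu theta x y.
Proof. by rewrite divr_ge0// mulr_ge0 ?powR_ge0// addr_ge0 ?fine_ball_ge0. Qed.

Lemma perimeter_kernelC theta x y :
  perimeter_kernel mu theta x y = perimeter_kernel mu theta y x.
Proof. by rewrite /perimeter_kernel (metric_sym y x) addrC. Qed.

Lemma measurable_perimeter_kernel theta :
  measurable_fun setT (fun z : cT * cT => perimeter_kernel mu theta z.1 z.2).
Proof.
apply: measurable_funM => //; apply: measurable_fun_inv.
  by move=> z; rewrite mulr_ge0 ?powR_ge0// addr_ge0 ?fine_ball_ge0.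
apply: measurable_funM; last first.
  apply: measurable_funD; first exact: measurable_fine_ball.
  exact: measurable_fine_ball_swap.
exact: (measurableT_comp (measurable_powR _) measurable_mdist).
Qed.

(** The ball about [y] is dropped from the denominator. *)
Lemma perimeter_kernel_le theta x y : x != y ->
  perimeter_kernel mu theta x y <= 2 * half_kernel theta (x, y).
Proof.
move=> xy; rewrite /perimeter_kernel /half_kernel ler_pM2l//=.
have d0 : 0 < mdist x y by rewrite mdist_gt0.
have p0 := powR_gt0 theta d0.
rewrite lef_pV2 ?posrE ?mulr_gt0 ?fine_ball_gt0//; last first.
  by rewrite ltr_pwDl ?fine_ball_gt0 ?fine_ball_ge0.
by rewrite ler_pM2l// lerDl fine_ball_ge0.
Qed.

(** By [ball_comparable] the sum of the two ball measures is at most [1 + Cmu] times the one about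
    [x]. *)
Lemma half_kernel_le theta x y : x != y ->
  half_kernel theta (x, y) <= (1 + Cmu) / 2 * perimeter_kernel mu theta x y.
Proof.
move=> xy; rewrite /perimeter_kernel /half_kernel /=.
have d0 : 0 < mdist x y by rewrite mdist_gt0.
have p0 := powR_gt0 theta d0.
have := ball_comparable Cmu1 mu_doubling xy.
have := fine_ball_gt0 xy; have := fine_ball_ge0 y (mdist x y).
move: (fine _) (fine _) (mdist x y `^ theta) p0 => fy fx p p0 fy0 fx0 fxy.
rewrite mulrA divfK// ler_pdivlMr ?mulr_gt0 ?ltr_pwDl// invfM.
rewrite mulrACA mulVf ?gt_eqF// mul1r ler_pdivrMl//; lra.
Qed.

End kernels.

(** * The two implications *)

Section equivalence.
Context {R : realType} {X : completeMetricType R}.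
Variable mu : {outer_measure set X -> \bar R}.
Hypothesis mu_borel : borel_regular mu.
Variable Cmu : R.
Hypothesis Cmu1 : 1 <= Cmu.
Hypothesis mu_doubling : doubling_with mu Cmu.
Implicit Types (x y : X) (r theta q tau : R).

Local Notation cT := (caratheodory_type mu).
Local Notation m := (cara_measure mu).
Let sm := cara_sigma mu_borel Cmu1 mu_doubling.

Section perimeter.
Variables (theta : R) (E Om : set cT).
Hypothesis mE : measurable E.
Hypothesis mOm : measurable Om.

Let pk (z : cT * cT) := (perimeter_kernel mu theta z.1 z.2)%:E.
Let pk0 z : (0 <= pk z)%E. Proof. by rewrite lee_fin perimeter_kernel_ge0. Qed.
Let mpk : measurable_fun setT pk.
Proof.
by apply/measurable_EFinP; exact: (measurable_perimeter_kernel mu_borel Cmu1 mu_doubling).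
Qed.
Let mOE : measurable (Om `&` E). Proof. exact: measurableI. Qed.
Let mOD : measurable (Om `\` E). Proof. exact: measurableD. Qed.

Lemma fractional_perimeterE :
  fractional_perimeter mu theta E Om =
  (\int[sm \x sm]_(z in (Om `&` E) `*` (Om `\` E)) pk z)%E.
Proof. by rewrite -integral_rect12. Qed.

(** Symmetry of the kernel, combined with Tonelli in the other order. *)
Lemma fractional_perimeter_swapE :
  fractional_perimeter mu theta E Om =
  (\int[sm \x sm]_(z in (Om `\` E) `*` (Om `&` E)) pk z)%E.
Proof.
rewrite -integral_rect21//; apply: eq_integral => x _; apply: eq_integral => y _.
by rewrite /pk /= perimeter_kernelC.
Qed.

Lemma fractional_perimeter_ge0 : (0 <= fractional_perimeter mu theta E Om)%E.
Proof. by rewrite fractional_perimeterE; exact: integral_ge0. Qed.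

(** The difference of the indicator at two points of [Om] is nonzero only on [R1] and [R2]. Each
    rectangle contributes [(1 + Cmu) / 2] times the perimeter. *)
Lemma indicator_energy_le :
  (\int[m]_(x in Om) \int[m]_(y in Om) (poincare_kernel mu theta \1_E x y)%:E <=
   (1 + Cmu)%:E * fractional_perimeter mu theta E Om)%E.
Proof.
pose R1 := (Om `&` E) `*` (Om `\` E); pose R2 := (Om `\` E) `*` (Om `&` E).
have mR1 : measurable R1 by exact: measurableX.
have mR2 : measurable R2 by exact: measurableX.
pose c := (1 + Cmu) / 2.
have c0 : 0 <= c by rewrite divr_ge0// addr_ge0// (le_trans _ Cmu1).
pose g z := (c%:E * ((pk \_ R1) z + (pk \_ R2) z))%E.
have r10 z : (0 <= (pk \_ R1) z)%E by exact: erestrict_ge0.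
have r20 z : (0 <= (pk \_ R2) z)%E by exact: erestrict_ge0.
have mr1 : measurable_fun setT (pk \_ R1).
  by apply/(measurable_restrictT _ _).1 => //; exact: measurable_funTS.
have mr2 : measurable_fun setT (pk \_ R2).
  by apply/(measurable_restrictT _ _).1 => //; exact: measurable_funTS.
have g0 z : (0 <= g z)%E by rewrite mule_ge0// adde_ge0.
have mg : measurable_fun setT g.
  by apply: emeasurable_funM => //; exact: emeasurable_funD.
have k0 x y : (0 <= (poincare_kernel mu theta \1_E x y)%:E)%E.
  by rewrite lee_fin poincare_kernelE mulr_ge0// half_kernel_ge0.
apply: (@le_trans _ _ (\int[sm]_(x in Om) \int[sm]_(y in Om) g (x, y))%E).
  apply: ge0_le_integral_sup => x Omx; first by apply: integral_ge0 => y _.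
  apply: ge0_le_integral_sup => y Omy //.
  rewrite poincare_kernelE /g !patchE /R1 /R2 !in_setX /=.
  rewrite !(in_setI, in_setD, in_setC) (mem_set Omx) (mem_set Omy) !indicE /=.
  have hle : x != y -> ((1 * half_kernel (mu := mu) theta (x, y))%:E <= c%:E * pk (x, y))%E.
    by move=> xy; rewrite mul1r -EFinM lee_fin (half_kernel_le Cmu1 mu_doubling).
  (* In the two mixed cases [x] and [y] differ, as only one of them is in [E], so [hle] applies. *)
  case xE : (x \in E); case yE : (y \in E) => /=;
    rewrite ?subrr ?normr0 ?mul0r ?subr0 ?sub0r ?normrN ?normr1 ?adde0 ?add0e ?mule0//.
  - by apply: hle; apply: contraFN yE => /eqP <-; rewrite xE.
  - by apply: hle; apply: contraFN xE => /eqP ->; rewrite yE.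
have mOO : measurable (Om `*` Om) by exact: measurableX.
rewrite integral_rect12//.
have -> : (\int[sm \x sm]_(z in Om `*` Om) g z = c%:E *
    (\int[sm \x sm]_(z in Om `*` Om) (pk \_ R1) z +
     \int[sm \x sm]_(z in Om `*` Om) (pk \_ R2) z))%E.
  rewrite -ge0_integralD//; last 2 first.
  - exact: measurable_funTS.
  - exact: measurable_funTS.
  rewrite -ge0_integralZl_EFin//; last first.
    by apply: measurable_funTS; exact: emeasurable_funD.
  by move=> z _; exact: adde_ge0.
rewrite -!integral_mkcondr.
rewrite (_ : (Om `*` Om) `&` R1 = R1); last first.
  by apply/seteqP; split => [z []//|[x y] [[] ? ? [] ? ?]].
rewrite (_ : (Om `*` Om) `&` R2 = R2); last first.
  by apply/seteqP; split => [z []//|[x y] [[] ? ? [] ? ?]].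
rewrite -fractional_perimeterE -fractional_perimeter_swapE.
have P0 := fractional_perimeter_ge0.
rewrite ge0_muleDr// -ge0_muleDl// -EFinD /c -splitr.
by [].
Qed.

End perimeter.

(** The mean [a] is at distance at least 1/2 from 1 or from 0, so the indicator deviates from it by
    at least 1/2 on all of [B & E] or on all of [B \ E]. *)
Lemma indicator_oscillation_ge (q : R) (B E : set cT) :
  1 <= q -> measurable B -> measurable E -> (0 < mu B)%E -> (mu B < +oo)%E ->
  ((mine (mu (B `&` E)) (mu (B `\` E)) * (fine (mu B))^-1%:E) `^ q^-1 <=
   2%:E * ((fine (mu B))^-1%:E *
     \int[m]_(x in B) ((`|\1_E x - avg mu \1_E B| `^ q)%R)%:E) `^ q^-1)%E.
Proof.
move=> q1 mB mE B0 Boo; have q0 : 0 < q by rewrite (lt_le_trans _ q1).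
set b := fine (mu B); set a := avg mu \1_E B.
have b0 : 0 < b by rewrite fine_gt0// B0.
set W := mine _ _.
have mBE : measurable (B `&` E) by exact: measurableI.
have mBD : measurable (B `\` E) by exact: measurableD.
have W0 : (0 <= W)%E by rewrite le_min !outer_measure_ge0.
pose f x : \bar R := (`|\1_E x - a| `^ q)%:E.
have f0 x : (0 <= f x)%E by rewrite lee_fin powR_ge0.
have mf : measurable_fun setT (f : cT -> \bar R).
  apply/measurable_EFinP; apply: (measurableT_comp (measurable_powR _)).
  by apply: measurableT_comp => //; apply: measurable_funB => //; exact: measurable_indic.
(* Here [c] is the constant value of the deviation on the part [C]. *)
have key (c : R) (C : set cT) : measurable C -> C `<=` B -> 2^-1 <= c ->
    (forall x, C x -> f x = (c `^ q)%:E) ->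
    ((2^-1 `^ q)%:E * mu C <= \int[m]_(x in B) f x)%E.
  move=> mC CB c2 fC; apply: (@le_trans _ _ (\int[m]_(x in C) f x)%E); last first.
    by apply: ge0_subset_integral => //; exact: measurable_funTS.
  rewrite (eq_integral (cst (c `^ q)%:E)); last first.
    by move=> x; rewrite inE => /fC.
  rewrite integral_cst//; apply: lee_wpmul2r => //.
  by rewrite lee_fin ge0_ler_powR ?(ltW q0) ?nnegrE// (le_trans _ c2).
have {}key : ((2^-1 `^ q)%:E * W <= \int[m]_(x in B) f x)%E.
  have [a2|a2] := leP a 2^-1.
    apply: (@le_trans _ _ ((2^-1 `^ q)%:E * mu (B `&` E))%E).
      by apply: lee_wpmul2l; rewrite ?lee_fin ?powR_ge0// ge_min lexx.
    apply: (key (1 - a)) => //; first by rewrite lerBrDl; lra.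
    move=> x [_ Ex]; rewrite /f indicE mem_set//= mulr1n ger0_norm//.
    by rewrite subr_ge0; lra.
  apply: (@le_trans _ _ ((2^-1 `^ q)%:E * mu (B `\` E))%E).
    by apply: lee_wpmul2l; rewrite ?lee_fin ?powR_ge0// ge_min lexx orbT.
  apply: (key a) => //; first exact: ltW.
  move=> x [_ Ex]; rewrite /f indicE memNset// sub0r normrN ger0_norm//.
  by rewrite ltW// (lt_trans _ a2).
have I0 : (0 <= \int[m]_(x in B) f x)%E by exact: integral_ge0.
have -> : ((W * b^-1%:E) `^ q^-1 =
    2%:E * ((2^-1 `^ q)%:E * (W * b^-1%:E)) `^ q^-1)%E.
  rewrite poweRM ?lee_fin ?powR_ge0 ?mule_ge0 ?lee_fin ?invr_ge0 ?(ltW b0)//.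
  rewrite poweR_EFin -powRrM mulfV ?gt_eqF// powRr1// muleA -EFinM mulfV// mul1e//.
rewrite lee_pmul2l//; apply: gt0_ler_poweR.
- by rewrite invr_ge0 ltW.
- by rewrite in_itv/= leey andbT !mule_ge0 ?lee_fin ?powR_ge0 ?invr_ge0 ?(ltW b0).
- by rewrite in_itv/= leey andbT mule_ge0 ?lee_fin ?invr_ge0 ?(ltW b0).
by rewrite muleA muleC; apply: lee_wpmul2l; rewrite ?lee_fin ?invr_ge0 ?(ltW b0).
Qed.

(** A set with compact closure lies in a ball, hence has finite measure. *)
Lemma L1loc_indic (E : set cT) : measurable E -> L1loc mu \1_E.
Proof.
move=> mE U oU cU; have [r r0 Ur] := bounded_compact (point : X) cU.
have mU : mu.-cara.-measurable U.
  by apply: (mu_borel.1); exact: sub_sigma_algebra.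
have Uoo : (mu U < +oo)%E.
  apply: le_lt_trans (ball_lty Cmu1 mu_doubling point r0).
  by apply: le_outer_measure; apply: subset_trans Ur; exact: subset_closure.
apply/integrableP; split.
  by apply/measurable_EFinP; exact: measurable_indic.
apply: (@le_lt_trans _ _ (\int[m]_(x in U) cst 1 x)%E).
  apply: ge0_le_integral_sup => // x _ /=.
  by rewrite lee_fin indicE; case: (_ \in _); rewrite ?normr1 ?normr0.
by rewrite integral_cst// mul1e.
Qed.

(** The factor 2 comes from [indicator_oscillation_ge], the factor [1 + Cmu] from
    [indicator_energy_le]. *)
Lemma poincare_isoperimetric theta q C tau : 1 <= q -> 1 <= C -> 1 <= tau ->
  0 < theta < 1 -> BBM_poincare_with mu theta q C tau ->
  BBM_isoperimetric_with mu theta q (2 * C * (1 + Cmu)) tau.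
Proof.
move=> q1 C1 tau1 /andP[th0 th1] HP x0 r r0 E mE.
cbv zeta; set B := ball x0 r; set tauB := ball x0 (tau * r).
have tr0 : 0 < tau * r by rewrite mulr_gt0// (lt_le_trans _ tau1).
have mB : mu.-cara.-measurable B by exact: ball_measurable.
have mtB : mu.-cara.-measurable tauB by exact: ball_measurable.
apply: (le_trans (indicator_oscillation_ge q1 mB mE _ _)).
- exact: (ball_gt0 mu_doubling).
- exact: (ball_lty Cmu1 mu_doubling).
have := HP x0 r r0 \1_E (L1loc_indic mE); cbv zeta; rewrite -/B -/tauB => {}HP.
have c0 : 0 <= C * (1 - theta) * r `^ theta.
  by rewrite !mulr_ge0 ?powR_ge0// ?subr_ge0 ?(ltW th1)// (le_trans _ C1).
have b0 : 0 <= (fine (mu tauB))^-1 by rewrite invr_ge0 fine_ge0.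
apply: (@le_trans _ _ (2%:E * ((C * (1 - theta) * r `^ theta)%:E *
    ((fine (mu tauB))^-1%:E *
      ((1 + Cmu)%:E * fractional_perimeter mu theta E tauB))))%E).
  rewrite lee_pmul2l//; apply: (le_trans HP).
  apply: lee_wpmul2l; first by rewrite lee_fin.
  by apply: lee_wpmul2l; [rewrite lee_fin|exact: indicator_energy_le].
rewrite (muleC (fractional_perimeter _ _ _ _)) !muleA -!EFinM.
rewrite (_ : (_ * (1 + Cmu))%R = (2 * C * (1 + Cmu) * (1 - theta) * r `^ theta / fine (mu tauB)))//.
by move: (fine (mu tauB))^-1 (r `^ theta) => ? ?; ring.
Qed.

(** In the factor 4, one 2 bounds the [2 ^ (1 / q)] of the oscillation estimate and the other comes
    from [perimeter_kernel_le]. *)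
Lemma isoperimetric_poincare theta q C tau : 1 <= q -> 1 <= C -> 1 <= tau ->
  0 < theta < 1 -> BBM_isoperimetric_with mu theta q C tau ->
  BBM_poincare_with mu theta q (4 * C) tau.
Proof.
move=> q1 C1 tau1 /andP[th0 th1] HI x0 r r0 u Lu.
cbv zeta; set B := ball x0 r; set tauB := ball x0 (tau * r).
have q0 : 0 < q by rewrite (lt_le_trans _ q1).
have tr0 : 0 < tau * r by rewrite mulr_gt0// (lt_le_trans _ tau1).
have mB : mu.-cara.-measurable B by exact: ball_measurable.
have mtB : mu.-cara.-measurable tauB by exact: ball_measurable.
have B0 : (0 < mu B)%E by exact: (ball_gt0 mu_doubling).
have Boo : (mu B < +oo)%E by exact: (ball_lty Cmu1 mu_doubling).
have BtB : B `<=` tauB by apply: sub_ball; rewrite mdistxx add0r ler_peMl// ltW.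
have iu : m.-integrable (tauB : set cT) (EFin \o u).
  exact: (L1loc_integrable_ball mu_borel Cmu1 mu_doubling).
(* Only integrability on [tauB] is known for [u]; extension by zero gives a function measurable on
   the whole space. *)
pose v : cT -> R := u \_ tauB.
have vE x : tauB x -> v x = u x by move=> tx; rewrite /v patchE mem_set.
have mv : measurable_fun setT v.
  apply/(measurable_restrictT _ _).1 => //.
  by apply/measurable_EFinP; exact: measurable_int iu.
have iv : m.-integrable (B : set cT) (EFin \o v).
  apply: (eq_integrable mB (EFin \o u)); last exact: integrableS iu.
  by move=> x; rewrite inE => Bx /=; rewrite vE//; exact: BtB.
have avgE : avg mu u B = avg mu v B.
  congr (_ * _); apply: eq_Rintegral => x; rewrite inE => Bx.
  by rewrite vE//; exact: BtB.
rewrite (eq_integral (fun x : cT => (`|v x - avg mu v B| `^ q)%:E)); last first.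
  by move=> x; rewrite inE => Bx; rewrite avgE vE//; exact: BtB.
apply: (le_trans (@mean_oscillation_le _ _ _ sm v B q mB B0 Boo mv iv q1)).
pose c := 4 * C * (1 - theta) * r `^ theta * (fine (mu tauB))^-1.
have c0 : 0 <= c.
  rewrite !mulr_ge0 ?powR_ge0 ?invr_ge0 ?fine_ge0 ?subr_ge0 ?(ltW th1)//.
  by rewrite (le_trans _ C1).
pose TT := (tauB : set cT) `*` (tauB : set cT).
have mTT : measurable TT by exact: measurableX.
pose hk (z : cT * cT) := (half_kernel theta z)%:E.
have hk0 z : (0 <= hk z)%E by rewrite lee_fin half_kernel_ge0.
have mhk : measurable_fun setT hk.
  by apply/measurable_EFinP; exact: (measurable_half_kernel mu_borel Cmu1 mu_doubling).
(* The target prefactor [c] and the cutoff to [TT] are put into the kernel, so that coarea applies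
   on the full product. *)
pose K z := (c%:E * (hk \_ TT) z)%E.
have hkT0 z : (0 <= (hk \_ TT) z)%E by exact: erestrict_ge0.
have K0 z : (0 <= K z)%E by rewrite mule_ge0.
have mhkT : measurable_fun setT (hk \_ TT).
  by apply/(measurable_restrictT _ _).1 => //; exact: measurable_funTS.
have mK : measurable_fun setT K by exact: emeasurable_funM.
have mv1 : measurable_fun setT (v \o @fst cT cT) by exact: measurableT_comp.
have mv2 : measurable_fun setT (v \o @snd cT cT) by exact: measurableT_comp.
apply: (@le_trans _ _ (\int[lebesgue_measure]_t
    \int[sm \x sm]_(z in between (v \o fst) (v \o snd) t) K z)%E).
  apply: ge0_le_integral_sup => t _; first exact: poweR_ge0.
  pose E : set cT := [set x | t < v x].
  have mE : measurable E.
    have mlt := measurable_fun_ltr (measurable_cst t) mv.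
    by have := mlt measurableT [set true] Logic.I; rewrite setTI.
  have W0 : (0 <= mine (mu (B `&` E)) (mu (B `\` E)))%E.
    by rewrite le_min !outer_measure_ge0.
  have P0 := fractional_perimeter_ge0 theta mE mtB.
  have := HI x0 r r0 E mE; cbv zeta; rewrite -/B -/tauB => HIE.
  apply: (@le_trans _ _ (2%:E * ((C * (1 - theta) * r `^ theta)%:E *
      (fractional_perimeter mu theta E tauB * (fine (mu tauB))^-1%:E)))%E).
    rewrite poweRM//; last by rewrite mule_ge0// lee_fin invr_ge0 fine_ge0.
    apply: lee_pmul => //; try exact: poweR_ge0.
    rewrite poweR_EFin lee_fin; apply: ler1_powR; first by lra.
    by rewrite invf_le1.
  (* Pairs with [x] in [E] and [y] outside are separated at level [t], so the rectangle of the
     perimeter sits inside [between] cut with [TT]. *)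
  have PK : (fractional_perimeter mu theta E tauB <=
      2%:E * \int[sm \x sm]_(z in between (v \o fst) (v \o snd) t) (hk \_ TT) z)%E.
    rewrite fractional_perimeterE// -integral_mkcondr.
    have mbt : measurable (between (v \o fst) (v \o snd) t `&` TT).
      by apply: measurableI => //; exact: measurable_between.
    rewrite -ge0_integralZl_EFin//; last exact: measurable_funTS.
    have mR : measurable (((tauB : set cT) `&` E) `*` ((tauB : set cT) `\` E)).
      by apply: measurableX; [exact: measurableI|exact: measurableD].
    apply: (@le_trans _ _ (\int[sm \x sm]_(z in
        ((tauB : set cT) `&` E) `*` ((tauB : set cT) `\` E)) (2%:E * hk z))%E).
      apply: ge0_le_integral_sup => [z _|[x y] [/= [_ Ex] [_ Ey]]].
        by rewrite lee_fin perimeter_kernel_ge0.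
      rewrite -EFinM lee_fin (perimeter_kernel_le Cmu1 mu_doubling)//.
      by apply/eqP => xy; apply: Ey; rewrite -xy.
    apply: ge0_subset_integral => //.
    - by apply: measurable_funTS; exact: emeasurable_funM.
    - by move=> z _; rewrite mule_ge0.
    - move=> [x y] [/= [tx Ex] [ty /negP]]; rewrite -leNgt => Ey; split => //.
      by rewrite /between /= ge_min lt_max Ex Ey orbT.
  have mbt : measurable (between (v \o fst) (v \o snd) t) by exact: measurable_between.
  rewrite /K ge0_integralZl_EFin//; last exact: measurable_funTS.
  have {PK} := @lee_wpmul2l _ (c / 2)%:E _ _ _ PK.
  rewrite lee_fin divr_ge0// => /(_ isT).
  rewrite muleA -EFinM divfK// => PK; apply: le_trans PK.
  rewrite (muleC (fractional_perimeter _ _ _ _)) !muleA -!EFinM.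
  rewrite (_ : (_ / fine (mu tauB))%R = c / 2)//.
  by rewrite /c; move: (fine (mu tauB))^-1 (r `^ theta) => ? ?; field.
(* Coarea read backwards reassembles the level sets into the energy of [v] on [TT], where [v] is
   [u]. *)
rewrite -(coarea (sigma_finite_prod sm sm) mv1 mv2 mK K0).
pose pv (z : cT * cT) := (poincare_kernel mu theta v z.1 z.2)%:E.
have pv0 z : (0 <= pv z)%E.
  by rewrite lee_fin poincare_kernelE mulr_ge0// half_kernel_ge0.
have mpv : measurable_fun setT pv.
  apply: (@emeasurable_funM _ _ _ _ (fun z => `|v z.1 - v z.2|%:E) hk) => //.
  by apply/measurable_EFinP; apply: measurableT_comp => //; exact: measurable_funB.
have mpvT : measurable_fun setT (pv \_ TT).
  by apply/(measurable_restrictT _ _).1 => //; exact: measurable_funTS.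
rewrite (eq_integral (fun z => c%:E * (pv \_ TT) z)%E); last first.
  move=> z _; rewrite /K muleCA !patchE.
  by case: ifPn => _; rewrite ?mule0// /pv poincare_kernelE EFinM.
rewrite ge0_integralZl_EFin//; last by move=> z _; exact: erestrict_ge0.
rewrite -integral_mkcond -integral_rect12//.
rewrite muleA -EFinM le_eqVlt; apply/orP; left; apply/eqP; congr (_ * _)%E.
apply: eq_integral => x; rewrite inE => tx.
by apply: eq_integral => y; rewrite inE => ty; rewrite /pv /poincare_kernel /= !vE.
Qed.

End equivalence.

Theorem theorem1p3 (R : realType) (X : completeMetricType R)
    (mu : {outer_measure set X -> \bar R})
    (mu_borel_regular : borel_regular mu) (mu_doubling : doubling mu)
    (q : R) (q_ge1 : 1 <= q) :
  (* the equivalence for each theta *)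
  (forall theta : R, 0 < theta < 1 ->
     supports_BBM_poincare mu theta q <-> supports_BBM_isoperimetric mu theta q)
  /\
  (* the resulting constants do not depend on theta *)
  (forall C tau : R, 1 <= C -> 1 <= tau ->
     exists C' tau' : R, [/\ 1 <= C', 1 <= tau' &
       forall theta : R, 0 < theta < 1 ->
         BBM_poincare_with mu theta q C tau ->
         BBM_isoperimetric_with mu theta q C' tau'])
  /\
  (forall C tau : R, 1 <= C -> 1 <= tau ->
     exists C' tau' : R, [/\ 1 <= C', 1 <= tau' &
       forall theta : R, 0 < theta < 1 ->
         BBM_isoperimetric_with mu theta q C tau ->
         BBM_poincare_with mu theta q C' tau']).
Proof.
have [Cmu Cmu1 mu_dbl] := mu_doubling.
(* The constants are fixed before [theta], so the equivalence for each [theta] follows from the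
   uniform statements. *)
have PI C tau : 1 <= C -> 1 <= tau -> exists C' tau' : R, [/\ 1 <= C', 1 <= tau' &
    forall theta : R, 0 < theta < 1 -> BBM_poincare_with mu theta q C tau ->
      BBM_isoperimetric_with mu theta q C' tau'].
  move=> C1 tau1; exists (2 * C * (1 + Cmu)), tau; split => //; first by nra.
  by move=> theta th; exact: poincare_isoperimetric.
have IP C tau : 1 <= C -> 1 <= tau -> exists C' tau' : R, [/\ 1 <= C', 1 <= tau' &
    forall theta : R, 0 < theta < 1 -> BBM_isoperimetric_with mu theta q C tau ->
      BBM_poincare_with mu theta q C' tau'].
  move=> C1 tau1; exists (4 * C), tau; split => //; first by lra.
  by move=> theta th; exact: (isoperimetric_poincare mu_borel_regular Cmu1 mu_dbl).
split; last by split.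
move=> theta th; split => -[C [tau [C1 tau1 H]]].
  by have [C' [tau' [? ? h]]] := PI C tau C1 tau1; exists C', tau'; split => //; exact: h H.
by have [C' [tau' [? ? h]]] := IP C tau C1 tau1; exists C', tau'; split => //; exact: h H.
Qed.
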